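(* Let $n,k,r$ be positive integers with $k\ge 2$, $r\ge 2$ and $n=2k+r$. Then the diameter of the Schrijver graph $\operatorname{SG}(n,k)$ equals $2$ if and only if $r\ge 2k-2$.
   Context: For positive integers $n\ge 2k$, write $[n]=\{1,\dots,n\}$. A subset of $[n]$ is 2-stable if it does not contain two cyclically consecutive elements of $[n]$ (where $1$ and $n$ are also considered consecutive). The Schrijver graph $\operatorname{SG}(n,k)$ has as vertices the 2-stable $k$-element subsets of $[n]$, and two vertices are adjacent if and only if they are disjoint. The diameter of a connected graph is the maximum, over pairs of vertices, of the length of a shortest path joining them. *)

(* Defs.v *)
From mathcomp Require Import all_boot.

Set Implicit Arguments.
Unset Strict Implicit.
Unset Printing Implicit Defensive.

Section Diameter.

Variables (T : finType) (e : rel T).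

Definition walk (x y : T) (p : seq T) : Prop := path e x p /\ last x p = y.

(* [path] allows repeated vertices; a walk of minimal length has none, so the
   minimum below is the length of a shortest (simple) path.  The list [p] omits
   the starting vertex, so [size p] counts edges. *)
Definition has_dist (x y : T) (d : nat) : Prop :=
  (exists2 p, walk x y p & size p = d) /\
  (forall p, walk x y p -> d <= size p).

(* A graph that is not connected satisfies this for no [d]. *)
Definition has_diameter (d : nat) : Prop :=
  (forall x y, exists2 d', has_dist x y d' & d' <= d) /\
  (exists x y, has_dist x y d).

End Diameter.

(* [n] = {1, ..., n} is represented by 'I_n, i.e. shifted to {0, ..., n - 1};
   [ordS] is the cyclic successor, with ordS (n - 1) = 0. *)
Definition two_stable (n : nat) (A : {set 'I_n}) : bool :=
  [forall i in A, ordS i \notin A].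

Definition schrijver_vertex (n k : nat) : predArgType :=
  {A : {set 'I_n} | (#|A| == k) && two_stable A}.

Definition schrijver_adj (n k : nat) : rel (schrijver_vertex n k) :=
  fun A B => [disjoint val A & val B].

(* Main.v *)
Require Import Defs.
From mathcomp Require Import all_boot.
From mathcomp Require Import zify.

Set Implicit Arguments.
Unset Strict Implicit.
Unset Printing Implicit Defensive.

(** A graph has diameter 2 exactly when it is not complete and any two distinct
    nonadjacent vertices have a common neighbour.  A common neighbour of [A] and
    [B] in the Schrijver graph is a stable k-set avoiding [A :|: B], so the
    question is how large a stable set fits in the complement of the union.

    Let [r >= 2k - 2], that is [n >= 4k - 2].  If [A] and [B] meet, their union
    has at most [2k - 1] elements, hence its complement [S] has at least
    [2k - 1].  A proper subset of a cycle splits into arcs, and taking every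
    other point of each arc, from its first point on, gives a stable set of at
    least [#|S| / 2] points, rounded up: here at least [k] of them
    ([exists_stable_subset], [common_neighbor]).

    Let [r <= 2k - 3].  The rounding up is harmless when all arcs of the
    complement have even length, which guides the choice
    [A = {0, 3, 5, .., 2k - 1}] and [B = {0, 4, 6, .., 2k}].  These meet in 0, and
    the complement of their union consists of [{1, 2}] and the arc from
    [2k + 1] to [n - 1], of length [r - 1].  A stable set has at most one point
    in the former and at most [r / 2], rounded down, in the latter, hence at
    most [k - 1] in all ([exists_far_pair]).  The same two sets are distinct and
    nonadjacent for every [r >= 2], so the graph is never complete. *)

Lemma diameter2P (T : finType) (e : rel T) :
  has_diameter e 2 <->
  (forall x y, x != y -> ~~ e x y -> exists2 z, e x z & e z y) /\
  (exists x y, x != y /\ ~~ e x y).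
Proof.
split.
  case=> short [a [b [_ min_ab]]]; split.
    move=> x y neq_xy nexy; have [_ [[p [xp lp] <-] _] le2] := short x y.
    case: p xp lp le2 => [|z [|t [|]]] //=.
    - by move=> _ eq_xy; rewrite eq_xy eqxx in neq_xy.
    - by move=> + eq_zy; rewrite eq_zy (negbTE nexy).
    - by move=> /and3P[exz ezt _] eq_ty _; exists z; rewrite -?eq_ty.
  exists a, b; split.
    by apply/eqP=> eq_ab; have := min_ab [::] (conj isT eq_ab).
  apply/negP=> eab; have := min_ab [:: b].
  by rewrite /walk /= eab => /(_ (conj isT erefl)).
case=> common [a [b [neq_ab neab]]].
have dist2 x y : x != y -> ~~ e x y -> has_dist e x y 2.
  move=> neq_xy nexy; split.
    have [z exz ezy] := common x y neq_xy nexy.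
    by exists [:: z; y] => //; split; rewrite //= exz ezy.
  case=> [|z [|t p]] //= [].
    by move=> _ /= eq_xy; rewrite eq_xy eqxx in neq_xy.
  by move=> + eq_zy; rewrite /= in eq_zy *; rewrite eq_zy (negbTE nexy).
split; last by exists a, b; apply: dist2.
move=> x y; have [<-|neq_xy] := eqVneq x y.
  by exists 0 => //; split=> //; exists [::].
case: (boolP (e x y)) => [exy|nexy]; last by exists 2 => //; apply: dist2.
exists 1 => //; split; first by exists [:: y] => //; split; rewrite //= exy.
by case=> [|z p] // [_ /= eq_xy]; rewrite eq_xy eqxx in neq_xy.
Qed.

Lemma val_iter_ordS n (u : 'I_n) i : val (iter i (@ordS n) u) = (u + i) %% n.
Proof.
elim: i => [|i IHi] /=; first by rewrite addn0 modn_small.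
by rewrite IHi -addn1 modnDml addn1 addnS.
Qed.

(** The cycle is connected: iterating the successor from a point outside [S]
    reaches every point of [S], so the walk has to enter [S] somewhere.  The
    entry point [ordS y] is the start of an arc of [S]. *)
Lemma exists_arc_start n (S : {set 'I_n}) (u x : 'I_n) :
  u \notin S -> x \in S -> exists2 y, ordS y \in S & y \notin S.
Proof.
move=> uS xS.
case: (boolP [exists y, (ordS y \in S) && (y \notin S)]).
  by case/existsP=> y /andP[]; exists y.
rewrite negb_exists => /forallP closedS.
have out i : iter i (@ordS n) u \notin S.
  elim: i => //= i IHi; apply/negP=> inS.
  by have := closedS (iter i (@ordS n) u); rewrite inS IHi.
have def_x : iter (n - u + x) (@ordS n) u = x.
  apply: val_inj; rewrite val_iter_ordS addnA subnKC; last exact: ltnW.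
  by rewrite modnDl modn_small.
by have := out (n - u + x); rewrite def_x xS.
Qed.

(** Greedy choice: the start of an arc of [S] is selected and its successor
    discarded.  Its predecessor is outside [S] already, so at most two points of
    [S] are used up for one selected point, and the rest of [S] can be treated
    independently.  The point [u] ensures that arcs have a start; on the
    full cycle of odd length the bound fails. *)
Lemma exists_stable_subset n k (S : {set 'I_n}) (u : 'I_n) :
  u \notin S -> 2 * k <= #|S|.+1 ->
  exists C : {set 'I_n}, [/\ C \subset S, #|C| = k & two_stable C].
Proof.
elim: k S => [|k IHk] S uS leS.
  exists set0; rewrite sub0set cards0; split=> //.
  by apply/forall_inP=> i; rewrite inE.
have [x xS] : exists x, x \in S by apply/set0Pn; rewrite -card_gt0; lia.
have [p] := exists_arc_start uS xS; set y := ordS p => yS pS.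
pose S' := S :\ y :\ ordS y.
have uS' : u \notin S' by rewrite !inE (negbTE uS) !andbF.
have leS' : 2 * k <= #|S'|.+1.
  move: leS; rewrite (cardsD1 y) yS (cardsD1 (ordS y) (S :\ y)) -/S'.
  by move: #|S'| => m; case: (ordS y \in _) => /=; lia.
have [C [/subsetP sCS' cardC /forall_inP stC]] := IHk S' uS' leS'.
have inC z : z \in C -> [/\ z != ordS y, z != y & z \in S].
  by move/sCS'; rewrite !inE => /and3P.
have yC : y \notin C by apply/negP=> /inC[_]; rewrite eqxx.
exists (y |: C); split.
- apply/subsetP=> z; rewrite !inE => /orP[/eqP->//|/inC[]//].
- by rewrite cardsU1 yC cardC.
apply/forall_inP=> z; rewrite !inE negb_or => /orP[/eqP->|zC].
  apply/andP; split; last by apply/negP=> /inC[]; rewrite eqxx.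
  apply/eqP=> fixy; have eq_py : p = y by apply: (@ordS_inj n); rewrite fixy.
  by rewrite eq_py yS in pS.
rewrite stC // andbT; apply/eqP=> /(@ordS_inj n) eq_zp.
by have [_ _] := inC z zC; rewrite eq_zp (negbTE pS).
Qed.

Lemma common_neighbor n k (A B : schrijver_vertex n k) :
  4 * k <= n + 2 -> ~~ schrijver_adj A B ->
  exists2 C, schrijver_adj A C & schrijver_adj C B.
Proof.
move=> le_n; rewrite /schrijver_adj -setI_eq0 => /set0Pn[u uAB].
have /andP[/eqP cardA _] := valP A; have /andP[/eqP cardB _] := valP B.
pose S := ~: (val A :|: val B).
have uS : u \notin S by move: uAB; rewrite !inE negbK => /andP[->].
have leS : 2 * k <= #|S|.+1.
  have I_gt0 : 0 < #|val A :&: val B| by apply/card_gt0P; exists u.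
  have := cardsCs S; have := cardsUI (val A) (val B).
  by rewrite setCK card_ord cardA cardB; lia.
have [C [sCS cardC stC]] := exists_stable_subset uS leS.
have vC : (#|C| == k) && two_stable C by rewrite cardC eqxx.
exists (exist _ C vC); rewrite /schrijver_adj /=;
  [rewrite disjoint_sym|]; rewrite disjoints_subset;
  by apply: subset_trans sCS _; rewrite setCS ?subsetUl ?subsetUr.
Qed.

Lemma exists_vertex n k (f : nat -> nat) :
    (forall i, i < k -> (f i).+1 < n) ->
    (forall i j, i < k -> j < k -> f i = f j -> i = j) ->
    (forall i j, i < k -> j < k -> (f i).+1 <> f j) ->
  exists A : schrijver_vertex n k,
    forall x : 'I_n, x \in val A <-> exists2 i, i < k & f i = x.
Proof.
move=> f_lt f_inj f_gap.
have lt_n (i : 'I_k) : f i < n by apply/ltnW/f_lt.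
pose A := [set Ordinal (lt_n i) | i : 'I_k].
have AP (x : 'I_n) : reflect (exists2 i, i < k & f i = x) (x \in A).
  apply: (iffP imsetP) => [[i _ ->]|[i lt_ik fi]]; first by exists i.
  by exists (Ordinal lt_ik) => //; apply: val_inj.
have vA : (#|A| == k) && two_stable A.
  apply/andP; split.
    rewrite card_imset ?card_ord // => i j [eq_f].
    by apply/val_inj/f_inj => //; apply: ltn_ord.
  apply/forall_inP=> x /AP[i lt_ik fi]; apply/negP=> /AP[j lt_jk /= fj].
  by apply: (f_gap i j) => //; rewrite fj -fi modn_small ?f_lt.
by exists (exist _ A vA) => x; split=> /AP.
Qed.

(** The point 0 is pinned and the other even numbers move by [t]: for [t = 1] and
    [t = 2], two stable sets that meet in 0 and otherwise interleave into one
    block of consecutive integers. *)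
Definition shifted_evens t i := if i == 0 then 0 else 2 * i + t.

Lemma exists_shifted_vertex n k t : 2 * k + t <= n ->
  exists A : schrijver_vertex n k, forall x : 'I_n,
    x \in val A <-> exists2 i, i < k & shifted_evens t i = x.
Proof.
by move=> le_n; apply: exists_vertex => [i|i j|i j]; rewrite /shifted_evens;
  do ?[case: eqP]; lia.
Qed.

(** The far pair is given together with its two unconditional properties, which
    also show that the graph is not complete when the diameter is 2.  When
    [n <= 4k - 3], common neighbours are excluded by grouping the integers into
    the pairs [{2i + 1, 2i + 2}]: a stable set has at most one point in each,
    and the complement of the union of the far pair meets too few of them. *)
Lemma exists_far_pair n k : 2 <= k -> 2 * k + 2 <= n ->
  exists A B : schrijver_vertex n k,
    [/\ A != B, ~~ schrijver_adj A B &
        n + 3 <= 4 * k ->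
        forall C, schrijver_adj A C -> schrijver_adj C B -> False].
Proof.
move=> k_ge2 le_n.
have [|A AP] := @exists_shifted_vertex n k 1; first by lia.
have [|B BP] := @exists_shifted_vertex n k 2; first by lia.
have n_gt0 : 0 < n by lia.
have n_gt3 : 3 < n by lia.
exists A, B; split.
- apply/eqP=> eqAB; have : Ordinal n_gt3 \in val B.
    by rewrite -eqAB; apply/AP; exists 1.
  by case/BP=> i _; rewrite /shifted_evens /=; case: eqP; lia.
- rewrite /schrijver_adj -setI_eq0; apply/set0Pn; exists (Ordinal n_gt0).
  by rewrite inE; apply/andP; split; [apply/AP | apply/BP]; exists 0 => //; lia.
move=> le_k C; rewrite /schrijver_adj disjoint_sym => dCA dCB.
have /andP[/eqP cardC /forall_inP stC] := valP C.
have inC (x : 'I_n) : x \in val C -> 0 < x < 3 \/ 2 * k < x.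
  move=> xC; have xA := disjointFr dCA xC; have xB := disjointFr dCB xC.
  have nA i : i < k -> shifted_evens 1 i <> x.
    move=> lt_ik fi; suff : x \in val A by rewrite xA.
    by apply/AP; exists i.
  have nB i : i < k -> shifted_evens 2 i <> x.
    move=> lt_ik fi; suff : x \in val B by rewrite xB.
    by apply/BP; exists i.
  (* The only indices at which the two sequences could reach [x], by parity. *)
  have := nA 0; have := nA x.-1./2; have := nB x.-2./2.
  by rewrite /shifted_evens; do 2![case: eqP => ?]; lia.
(* The index [i] of the pair [{2i + 1, 2i + 2}] containing [x]. *)
pose g (x : 'I_n) := x.-1./2.
have g_inj : {in val C &, injective g}.
  have no_succ (x y : 'I_n) : x \in val C -> y \in val C -> y <> x.+1 :> nat.
    move=> xC yC eq_y; have := stC x xC; suff -> : ordS x = y by rewrite yC.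
    by apply: val_inj; rewrite /= modn_small -eq_y.
  move=> x y xC yC; rewrite /g => eq_g; apply: val_inj => /=.
  have := no_succ x y xC yC; have := no_succ y x yC xC.
  by have := inC x xC; have := inC y yC; lia.
have : size (map g (enum (val C))) <= size (0 :: iota k (k - 2)).
  apply: uniq_leq_size.
    rewrite map_inj_in_uniq ?enum_uniq // => x y.
    by rewrite !mem_enum; apply: g_inj.
  move=> _ /mapP[x + ->]; rewrite mem_enum => /inC xC.
  by rewrite inE mem_iota /g; have := ltn_ord x; lia.
by rewrite size_map -cardE cardC /= size_iota; lia.
Qed.

Theorem theorem2 (n k r : nat) (hk : 2 <= k) (hr : 2 <= r) (hn : n = 2 * k + r) :
  has_diameter (@schrijver_adj n k) 2 <-> 2 * k - 2 <= r.
Proof.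
have [|A [B [neqAB nadjAB far]]] := @exists_far_pair n k hk; first by lia.
rewrite diameter2P; split=> [[common _]|le_r].
  have [C adjAC adjCB] := common A B neqAB nadjAB.
  by rewrite leqNgt; apply/negP=> lt_r; apply: (far _ C) => //; lia.
split; last by exists A, B.
by move=> X Y _; apply: common_neighbor; lia.
Qed.
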